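(* Let $F:M\to N$ be a smooth immersion, let $\Gamma$ be a smooth submanifold of $N$, and let $p$ be a point in $\Gamma$. Let $V_1,V_2,\dots,V_k$ be the tangent planes to the sheets of $F:M\to N$ that pass through $p$. Then (1) $F$ is strongly transverse to $\Gamma$ at $p$ if and only if $V_1,V_2,\dots,V_k,\operatorname{Tan}(\Gamma,p)$ are strongly transverse subspaces of $\operatorname{Tan}(N,p)$. (2) $F$ is strongly self-transverse at $p$ if and only if $V_1,V_2,\dots,V_k$ are strongly transverse subspaces of $\operatorname{Tan}(N,p)$.
   Context: The tangent planes to the sheets through $p$ are: writing $F^{-1}(p)=\{x_1,\dots,x_k\}$ (a finite set of $k$ distinct points), $V_i=DF(x_i)(\operatorname{Tan}(M,x_i))\subset\operatorname{Tan}(N,p)$. Linear subspaces $V_1,\dots,V_r$ of a finite-dimensional Euclidean space $V$ are strongly transverse if: whenever $v_i\in V_i^\perp$ for each $i$ and $\sum_i v_i=0$, then $v_1=\dots=v_r=0$. (This does not depend on the choice of inner product on $V$.) For a set $S$ and $j\ge1$, $\Delta^jS=\{(y_1,\dots,y_j)\in S^j:y_1=\dots=y_j\}$ and $\Omega^jS=\{(y_1,\dots,y_j)\in S^j: y_a\neq y_b\text{ for } a\ne b\}$. $F$ is strongly transverse to $\Gamma$ if for every $j\ge1$ the map $\widetilde F:\Omega^jM\to N^j$, $\widetilde F(y_1,\dots,y_j)=(F(y_1),\dots,F(y_j))$, is transverse to $\Delta^j\Gamma$. $F$ is strongly transverse to $\Gamma$ at $p\in\Gamma$ if for every $j\ge1$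 this transversality condition holds at every $(y_1,\dots,y_j)\in\Omega^jM$ with $F(y_1)=\dots=F(y_j)=p$. $F$ is strongly self-transverse (at $p$) if it is strongly transverse to $N$ (at $p$), i.e. the case $\Gamma=N$. *)

(* Defs.v *)
From HB Require Import structures.
From mathcomp Require Import all_boot all_order all_algebra.
From mathcomp Require Import sesquilinear.
From mathcomp Require Import all_classical all_reals all_analysis.

Set Implicit Arguments.
Unset Strict Implicit.
Unset Printing Implicit Defensive.

Import Order.TTheory GRing.Theory Num.Theory.
Import numFieldNormedType.Exports.

Local Open Scope classical_set_scope.
Local Open Scope ring_scope.

Section smooth_maps.
Context {R : realType} {V W : normedModType R}.

(* Meant for an open set [U]; in finite dimension this is the usual notion of
   a C^k map, expressed by iterated directional derivatives. *)
Fixpoint Ck_on (k : nat) (U : set V) (f : V -> W) : Prop :=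
  match k with
  | 0 => forall u, U u -> {for u, continuous f}
  | k'.+1 => (forall u, U u -> differentiable f u) /\
             (forall v, Ck_on k' U ('D_v f))
  end.

Definition smooth_on (U : set V) (f : V -> W) : Prop :=
  forall k, Ck_on k U f.

Definition smooth_near (u : V) (f : V -> W) : Prop :=
  exists2 U : set V, open_nbhs u U & smooth_on U f.

End smooth_maps.

Section charts.
Context {R : realType}.

(* [cmap] and [cinv] are total functions, but only their values on [cdom] and
   on [cmap @` cdom] are meaningful. *)
Record chart (T : Type) (n : nat) := Chart {
  cdom : set T;
  cmap : T -> 'rV[R]_n;
  cinv : 'rV[R]_n -> T
}.

Definition is_chart (T : topologicalType) (n : nat) (c : chart T n) : Prop :=
  [/\ open (cdom c),
      open (cmap c @` cdom c),
      (forall x, cdom c x -> cinv c (cmap c x) = x),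
      (forall x, cdom c x -> {for x, continuous (cmap c)}) &
      (forall u, (cmap c @` cdom c) u -> {for u, continuous (cinv c)})].

Definition smooth_transition (T : Type) (n : nat) (c c' : chart T n) : Prop :=
  smooth_on (cmap c @` (cdom c `&` cdom c')) (cmap c' \o cinv c).

End charts.
Arguments chart : clear implicits.

(* The atlas is indexed by the points, [chart_at x] being a chart around [x];
   every smooth structure is given by such an atlas.  The tangent space
   Tan(M, x) is R^n, a class of curves through [x] being identified with its
   velocity in the chart [chart_at x]. *)
Record charted (R : realType) (n : nat) := Charted {
  carrier :> topologicalType;
  chart_at : carrier -> chart R carrier n
}.
Arguments chart_at {R n c} : rename.

Section manifolds.
Context {R : realType}.

Definition smooth_manifold (n : nat) (M : charted R n) : Prop :=
  [/\ hausdorff_space M,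
      @second_countable M,
      (forall x : M, is_chart (chart_at x) /\ cdom (chart_at x) x) &
      (forall x y : M, smooth_transition (chart_at x) (chart_at y))].

(* M^j; its model space R^(j * n) is 'M[R]_(j, n) flattened by [mxvec]. *)
Definition power_chart (n : nat) (M : charted R n) (j : nat) (y : 'I_j -> M) :
    chart R (prod_topology (fun _ : 'I_j => M)) (j * n) :=
  Chart [set z : 'I_j -> M | forall a, cdom (chart_at (y a)) (z a)]
        (fun z : 'I_j -> M => mxvec (\matrix_(a < j) cmap (chart_at (y a)) (z a)))
        (fun u (a : 'I_j) => cinv (chart_at (y a)) (row a (vec_mx u))).

Definition power (n : nat) (M : charted R n) (j : nat) : charted R (j * n) :=
  @Charted R (j * n) (prod_topology (fun _ : 'I_j => M)) (@power_chart n M j).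

(* [set_type A] carries the subspace topology; [A] is meant to be open. *)
Definition open_part_chart (n : nat) (M : charted R n) (A : set M)
    (y : set_type A) : chart R (set_type A) n :=
  Chart [set z : set_type A | cdom (chart_at (\val y)) (\val z)]
        (fun z : set_type A => cmap (chart_at (\val y)) (\val z))
        (fun u => insubd y (cinv (chart_at (\val y)) u)).

Definition open_part (n : nat) (M : charted R n) (A : set M) : charted R n :=
  @Charted R n (set_type A) (@open_part_chart n M A).

Definition local_rep (m n : nat) (M : charted R m) (N : charted R n)
    (F : M -> N) (x : M) : 'rV[R]_m -> 'rV[R]_n :=
  cmap (chart_at (F x)) \o F \o cinv (chart_at x).

Definition smooth_map (m n : nat) (M : charted R m) (N : charted R n)
    (F : M -> N) : Prop :=
  continuous F /\
  forall x, smooth_near (cmap (chart_at x) x) (local_rep F x).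

(* DF(x) : Tan(M, x) -> Tan(N, F x) *)
Definition differential (m n : nat) (M : charted R m) (N : charted R n)
    (F : M -> N) (x : M) : 'Hom('rV[R]_m, 'rV[R]_n) :=
  linfun ('d (local_rep F x) (cmap (chart_at x) x)).

Definition immersion (m n : nat) (M : charted R m) (N : charted R n)
    (F : M -> N) : Prop :=
  smooth_map F /\ forall x, injective (differential F x).

(* Near each of its points, [S] is a d-dimensional coordinate slice of a chart
   of the maximal atlas of [N]. *)
Definition submanifold (n : nat) (N : charted R n) (d : nat) (S : set N) :
    Prop :=
  (d <= n)%N /\
  forall q, S q -> exists c : chart R N n,
    [/\ is_chart c, cdom c q,
        (forall x : N, smooth_transition c (chart_at x) /\
                       smooth_transition (chart_at x) c) &
        (forall z, cdom c z ->
           (S z <-> forall i : 'I_n, (d <= i)%N -> cmap c z 0 i = 0))].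

Definition velocity (n : nat) (N : charted R n) (S : set N) (b : N)
    (v : 'rV[R]_n) : Prop :=
  exists c : R -> N,
    [/\ c 0 = b,
        (\forall t \near (0 : R), S (c t) /\ cdom (chart_at b) (c t)),
        smooth_near (0 : R^o) (cmap (chart_at b) \o c : R^o -> 'rV[R]_n) &
        v = derive1 (cmap (chart_at b) \o c) 0].

(* For [b] in a submanifold [S] the velocities form a linear subspace, so the
   default value 0 is irrelevant. *)
Definition Tan (n : nat) (N : charted R n) (S : set N) (b : N) :
    {vspace 'rV[R]_n} :=
  xget 0%VS [set W : {vspace 'rV[R]_n} | forall v, v \in W <-> velocity S b v].

Definition transverse_at (m n : nat) (A : charted R m) (B : charted R n)
    (f : A -> B) (S : set B) (a : A) : Prop :=
  S (f a) -> (limg (differential f a) + Tan S (f a))%VS = fullv.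

Definition diag (S : Type) (j : nat) (G : set S) : set ('I_j -> S) :=
  [set z | (forall a, G (z a)) /\ (forall a b, z a = z b)].

Definition offdiag (S : Type) (j : nat) : set ('I_j -> S) :=
  [set y | forall a b, a != b -> y a <> y b].

Definition Omega (m : nat) (M : charted R m) (j : nat) : charted R (j * m) :=
  @open_part (j * m) (power M j) (@offdiag M j).

Definition tilde (m n : nat) (M : charted R m) (N : charted R n) (F : M -> N)
    (j : nat) (y : Omega M j) : power N j :=
  fun a => F (set_val y a).

Definition strongly_transverse_at (m n : nat) (M : charted R m)
    (N : charted R n) (F : M -> N) (G : set N) (p : N) : Prop :=
  forall j, (0 < j)%N -> forall y : Omega M j, (forall a, F (set_val y a) = p) ->
    transverse_at (tilde F (j := j)) (@diag N j G : set (power N j)) y.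

Definition strongly_self_transverse_at (m n : nat) (M : charted R m)
    (N : charted R n) (F : M -> N) (p : N) : Prop :=
  strongly_transverse_at F [set: N] p.

End manifolds.

(* [g] is an inner product; [orthov g V] is the orthogonal complement of [V]. *)
Definition strongly_transverse_subspaces (R : realType) (E : vectType R)
    (g : {dot E for idfun}) (r : nat) (V : r.-tuple {vspace E}) : Prop :=
  forall v : 'I_r -> E,
    (forall i, v i \in orthov g (tnth V i)) -> \sum_(i < r) v i = 0 ->
    forall i, v i = 0.

(* Main.v *)
From HB Require Import structures.
Require Import Defs.
From mathcomp Require Import all_boot all_order all_algebra.
From mathcomp Require Import sesquilinear.
From mathcomp Require Import all_classical all_reals all_analysis.

(** At a point [y] of the configuration space lying over [p], the differential of
    [tilde F] is the direct sum of the differentials of [F] at the points [y a],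
    and the tangent space of the diagonal of [Gamma] is the diagonal copy of
    [Tan Gamma p].  Transversality of [tilde F] at [y] therefore reads
      [(+)_a limg DF(y a) + diagonal (Tan Gamma p) = (R^n)^j].
    A subspace is everything when its orthogonal complement is 0; computing that
    complement for the inner product induced by [g] on (R^n)^j turns the equation
    into: if [v a] is orthogonal to [limg DF(y a)] for all [a], and the sum of the
    [v a] is orthogonal to [Tan Gamma p], then all [v a] are 0
    ([block_transverseP]).  For [y] the full fiber, this is strong transversality
    of [V_1, ..., V_k, Tan Gamma p], the last vector being minus the sum of the
    others ([strongly_transverse_rconsP]).  For a shorter [y] the condition follows
    from that of the full fiber after extension by 0, and longer [y] do not exist
    ([strongly_transverse_atP]).

    Two geometric facts support this.  The velocities of a submanifold at a point
    form a linear subspace, described by means of a slice chart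
    ([velocity_sliceP]), and those of the diagonal are the diagonal copies of them
    ([velocity_diag]).  Injective families form an open set in a Hausdorff
    manifold, hence locally [tilde F] is a product of copies of [F]
    ([limg_differential_tilde]).

    The self-transverse case is the case of the submanifold [Gamma = N], for which
    the tangent space is the whole space and its orthogonal complement is 0. *)

Set Implicit Arguments.
Unset Strict Implicit.
Unset Printing Implicit Defensive.

Import Order.TTheory GRing.Theory Num.Theory.
Import numFieldNormedType.Exports.

Local Open Scope classical_set_scope.
Local Open Scope ring_scope.

(** * Differentials and smooth maps of normed spaces *)

(** A linear map on matrices is a finite combination of the coordinate
    functions, which are continuous. *)
Lemma linear_mx_continuous (R : realType) (m n : nat) (W : normedModType R)
    (f : {linear 'M[R]_(m, n) -> W}) : continuous f.
Proof.
have -> : (f : 'M[R]_(m, n) -> W) =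
    fun u => \sum_(i < m) \sum_(j < n) u i j *: f (delta_mx i j).
  apply/funext => u; rewrite {1}(matrix_sum_delta u) linear_sum.
  by apply: eq_bigr => i _; rewrite linear_sum; apply: eq_bigr => j _;
     rewrite linearZ.
apply: continuous_big => [|i _]; first exact: add_continuous.
apply: continuous_big => [|j _ u]; first exact: add_continuous.
exact: (@cvgZr_tmp _ _ _ (nbhs u) _ _ _ _ (@coord_continuous R m n i j u)).
Qed.
Arguments linear_mx_continuous {R m n W} f [x t] _.

Section calculus.
Context {R : realType} {V W : normedModType R}.

(** The differential is chosen by an epsilon operator on the whole function, so
    its locality has to be recovered from the uniqueness of the first-order
    expansion. *)
Lemma near_eq_diff (f g : V -> W) (a : V) :
  (\near a, f a = g a) -> differentiable f a ->
  differentiable g a /\ 'd g a = 'd f a :> (V -> W).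
Proof.
move=> fg df; have fga := nbhs_singleton fg.
have dfc : continuous ('d f a) by exact: diff_continuous.
have exp : g \o shift a = cst (g a) + 'd f a +o_ 0 id.
  apply/eqaddoP => e e0.
  have /eqaddoP/(_ e e0) := diff_locally df.
  have fg' : \forall h \near 0, f (h + a) = g (h + a).
    move: fg; rewrite (near_shift 0)/=.
    by apply: filterS => h; rewrite /= subr0.
  apply: filter_app; apply: filterS fg' => h /=.
  by rewrite !fctE /= fga => ->.
have dga := diff_unique dfc exp.
by split=> //; apply/diff_locallyP; rewrite dga.
Qed.

Lemma open_near_eq (U : set V) (f g : V -> W) :
  open U -> {in U, f =1 g} -> forall u, U u -> \near u, f u = g u.
Proof.
move=> oU fg u Uu.
have : nbhs u U by exact: open_nbhs_nbhs.
by apply: filterS => z Uz; apply: fg; rewrite inE.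
Qed.

(** Openness of [U] matters: the derivatives at the points of [U] must only see
    values taken in [U]. *)
Lemma Ck_on_eq (k : nat) (U : set V) (f g : V -> W) :
  open U -> {in U, f =1 g} -> Ck_on k U f -> Ck_on k U g.
Proof.
move=> oU; elim: k f g => [|k IHk] f g fg.
  move=> cf u Uu; have fgu := open_near_eq oU fg Uu.
  have cfu : f @ u --> f u := cf u Uu.
  rewrite /prop_for /continuous_at -(nbhs_singleton fgu).
  apply: cvg_trans cfu; apply: near_eq_cvg.
  by apply: filterS fgu => z.
case=> df Cf; split=> [u Uu|v].
  by have [] := near_eq_diff (open_near_eq oU fg Uu) (df u Uu).
apply: IHk (Cf v) => u; rewrite inE => Uu.
exact: near_eq_derive (open_near_eq oU fg Uu).
Qed.

End calculus.

Lemma diff_linear_comp (R : realType) (V W X : normedModType R)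
    (L : {linear W -> X}) (f : V -> W) (u : V) :
  continuous L -> differentiable f u ->
  differentiable (L \o f) u /\ 'd (L \o f) u = L \o 'd f u :> (V -> X).
Proof.
move=> cL df; have dL := linear_differentiable (f u) cL.
split; first exact: differentiable_comp.
by rewrite diff_comp // diff_lin.
Qed.

Lemma Ck_on_linear_comp (R : realType) (V W X : normedModType R)
    (L : {linear W -> X}) (k : nat) (U : set V) (f : V -> W) :
  open U -> continuous L -> Ck_on k U f -> Ck_on k U (L \o f).
Proof.
move=> oU cL; elim: k f => [|k IHk] f.
  move=> cf u Uu; apply: continuous_comp; first exact: cf.
  exact: cL.
case=> df Cf; split=> [u Uu|v].
  by have [] := diff_linear_comp cL (df u Uu).
apply: Ck_on_eq (IHk _ (Cf v)) => // u; rewrite inE => Uu.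
have [dLf dLfE] := diff_linear_comp cL (df u Uu).
by rewrite deriveE // dLfE /= deriveE //; exact: df.
Qed.

(** Curves in a submanifold will be obtained by pulling a straight line back
    through a slice chart.  Along a line, directional derivatives of all orders
    are directional derivatives of the outer function, which gives smoothness
    without a chain rule for higher derivatives. *)
Section line.
Context {R : realType} {V W : normedModType R} (a w : V).

Definition line (t : R^o) : V := a + t *: w.

Lemma is_diff_line (t : R^o) : is_diff t line (fun s => s *: w).
Proof. by apply: is_diff_eq; rewrite add0r. Qed.

Lemma continuous_line : continuous line.
Proof.
by move=> t; apply: differentiable_continuous; have := is_diff_line t => -[].
Qed.

Lemma diff_line_comp (f : V -> W) (t : R^o) : differentiable f (line t) ->
  differentiable (f \o line) t /\
  'd (f \o line) t = (fun s => 'd f (line t) (s *: w)) :> (R^o -> W).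
Proof.
move=> df; have [dl dlE] := is_diff_line t.
by split; [exact: differentiable_comp | rewrite diff_comp // dlE].
Qed.

Lemma Ck_on_line_comp (k : nat) (U : set V) (f : V -> W) :
  open U -> Ck_on k U f -> Ck_on k (line @^-1` U) (f \o line).
Proof.
move=> oU.
have oU' : open (line @^-1` U).
  by apply: open_comp => // t _; exact: continuous_line.
elim: k f => [|k IHk] f.
  move=> cf t Ut; apply: continuous_comp; first exact: continuous_line.
  exact: cf.
case=> df Cf; split=> [t Ut|v].
  by have [] := diff_line_comp (df _ Ut).
apply: Ck_on_eq (IHk _ (Cf (v *: w))) => // t; rewrite inE => Ut.
have [dfl dflE] := diff_line_comp (df _ Ut).
by rewrite [RHS]deriveE // dflE /= deriveE //; exact: df.
Qed.

End line.

Lemma smooth_near_differentiable (R : realType) (V W : normedModType R)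
    (u : V) (f : V -> W) : smooth_near u f -> differentiable f u.
Proof. by case=> U [_ Uu] /(_ 1%N) [df _]; exact: df. Qed.

(** This is how the differentials of two inverse changes of charts are seen to be
    inverse to each other. *)
Lemma diff_near_inverse (R : realType) (V W : normedModType R) (f : V -> W)
    (g : W -> V) (a : V) (b : W) :
  f a = b -> differentiable f a -> differentiable g b ->
  (\near a, g (f a) = a) -> forall v, 'd g b ('d f a v) = v.
Proof.
move=> <- df dg gfK v.
have dgf : differentiable (g \o f) a by exact: differentiable_comp.
have [_ E] := near_eq_diff (g := id) gfK dgf.
have -> : 'd g (f a) ('d f a v) = 'd (g \o f) a v by rewrite (diff_comp df dg).
by rewrite -E; have [_ ->] := is_diff_id a.
Qed.

Lemma derive1_chain (R : realType) (V W : normedModType R) (h : R^o -> V)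
    (f : V -> W) (t : R^o) (a : V) :
  h t = a -> differentiable h t -> differentiable f a ->
  differentiable (f \o h) t /\ derive1 (f \o h) t = 'd f a (derive1 h t).
Proof.
move=> <- dh df; have dfh : differentiable (f \o h) t.
  exact: differentiable_comp.
split=> //.
by rewrite (derive1E' dfh) (derive1E' dh) (diff_comp dh df).
Qed.

Lemma derive1_linear_comp (R : realType) (V W : normedModType R)
    (L : {linear V -> W}) (h : R^o -> V) (t : R^o) :
  continuous L -> differentiable h t ->
  derive1 (L \o h) t = L (derive1 h t).
Proof.
move=> cL dh.
have [_ ->] := derive1_chain erefl dh (linear_differentiable (h t) cL).
by rewrite diff_lin.
Qed.

Lemma smooth_near_linear_comp (R : realType) (V W X : normedModType R)
    (L : {linear W -> X}) (f : V -> W) (u : V) :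
  continuous L -> smooth_near u f -> smooth_near u (L \o f).
Proof.
move=> cL [U oU Uf]; exists U => // k.
by apply: Ck_on_linear_comp (Uf k) => //; case: oU.
Qed.

(** * Tangent spaces of submanifolds *)

Lemma chart_image_open (R : realType) (T : topologicalType) (n : nat)
    (c : chart R T n) (A : set T) :
  is_chart c -> open A -> open (cmap c @` (cdom c `&` A)).
Proof.
case=> oD oI cK _ ic oA.
have -> : cmap c @` (cdom c `&` A) = cmap c @` cdom c `&` cinv c @^-1` A.
  apply/seteqP; split=> [_ [z [Dz Az] <-]|u [[z Dz <-]]].
    by split; [exists z | rewrite /preimage/= cK].
  by rewrite /preimage /= cK // => Az; exists z.
rewrite openE => u [Iu Au]; apply: filterI.
  exact: open_nbhs_nbhs.
by apply: ic => //; exact: open_nbhs_nbhs.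
Qed.

(** The choice made in the definition of [Tan] is harmless as soon as some
    subspace consists exactly of the velocities. *)
Lemma mem_Tan (R : realType) (n : nat) (N : charted R n) (S : set N) (b : N)
    (W : {vspace 'rV[R]_n}) :
  (forall v, v \in W <-> velocity S b v) ->
  forall v, v \in Tan S b <-> velocity S b v.
Proof.
by move=> hW; apply: (@xgetPex _ 0%VS [set U : {vspace _} |
  forall v, v \in U <-> velocity S b v]); exists W.
Qed.

(** A slice chart [c] straightens [S] near [p].  Writing [sigma] for the change of
    coordinates from the preferred chart at [p] to [c], a vector [v] is a
    velocity of [S] exactly when the last coordinates of [D sigma v] vanish: a
    curve in [S] keeps its last [c]-coordinates equal to 0, and conversely the
    [c]-preimage of the line through [cmap c p] directed by [D sigma v] stays in
    [S]. *)
Section slice.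
Context {R : realType} {n : nat} {N : charted R n} (hN : smooth_manifold N).
Context {S : set N} {d : nat} {p : N} {c : chart R N n}.
Hypotheses (hc : is_chart c) (cp : cdom c p) (Sp : S p)
  (hct : smooth_transition c (chart_at p))
  (htc : smooth_transition (chart_at p) c)
  (hslice : forall z, cdom c z ->
    (S z <-> forall i : 'I_n, (d <= i)%N -> cmap c z 0 i = 0)).

Let psi := chart_at p.
Let sigma := cmap c \o cinv psi.
Let tau := cmap psi \o cinv c.

Let hpsi : is_chart psi. Proof. by case: hN => _ _ /(_ p)[]. Qed.
Let psip : cdom psi p. Proof. by case: hN => _ _ /(_ p)[]. Qed.
Let openc : open (cdom c). Proof. by case: hc. Qed.
Let openpsi : open (cdom psi). Proof. by case: hpsi. Qed.

Let cpsiK z : cdom psi z -> cinv psi (cmap psi z) = z.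
Proof. by case: hpsi => _ _ + _ _; apply. Qed.
Let ccK z : cdom c z -> cinv c (cmap c z) = z.
Proof. by case: hc => _ _ + _ _; apply. Qed.

Let dsigma : differentiable sigma (cmap psi p).
Proof.
have [ds _] := htc 1%N; apply: ds.
by exists p.
Qed.

Let dtau : differentiable tau (cmap c p).
Proof. by have [ds _] := hct 1%N; apply: ds; exists p. Qed.

Let tau_sigma (v : 'rV[R]_n) :
  'd tau (cmap c p) ('d sigma (cmap psi p) v) = v.
Proof.
apply: diff_near_inverse dsigma dtau _ v; first by rewrite /sigma /= cpsiK.
apply: (open_near_eq (chart_image_open hpsi openc)); last by exists p.
move=> u; rewrite inE => -[z [psiz cz] <-].
by rewrite /= /sigma /= cpsiK // /tau /= ccK.
Qed.

Let velocity_slice1 v : velocity S p v ->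
  forall i : 'I_n, (d <= i)%N -> 'd sigma (cmap psi p) v 0 i = 0.
Proof.
case=> g [g0 gS /smooth_near_differentiable dg gv] i di.
set h : R^o -> 'rV[R]_n := cmap psi \o g in dg.
have h0 : h 0 = cmap psi p by rewrite /h /= g0.
have [dsh dshE] := derive1_chain h0 dg dsigma.
rewrite gv -/psi -/h -dshE derive1E.
(* The slice equation only speaks of points of [cdom c], where the curve stays
   for small times. *)
have nearc : \forall t \near (0 : R^o), cdom c (cinv psi (h t)).
  have cih : {for (0 : R^o), continuous (cinv psi \o h)}.
    apply: continuous_comp; first exact: differentiable_continuous.
    by case: hpsi => _ _ _ _; apply; rewrite h0; exists p.
  by apply: cih; rewrite /= h0 cpsiK //; exact: open_nbhs_nbhs.
rewrite derive_mx; last exact: diff_derivable.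
rewrite mxE.
apply: (@etrans _ _ ('D_1 (cst (0 : R^o)) (0 : R^o))); last exact: derive_cst.
apply: near_eq_derive; near=> t.
have [St psit] : S (g t) /\ cdom psi (g t) by near: t.
have ct : cdom c (cinv psi (h t)) by near: t.
move: ct; rewrite /sigma /h /= cpsiK // => ct.
by apply: (hslice ct).1.
Unshelve. all: by end_near. Qed.

Let velocity_slice2 v :
  (forall i : 'I_n, (d <= i)%N -> 'd sigma (cmap psi p) v 0 i = 0) ->
  velocity S p v.
Proof.
move=> vi; set w := 'd sigma (cmap psi p) v in vi.
pose l := line (cmap c p) w.
pose O := cmap c @` (cdom c `&` cdom psi).
have oO : open O by exact: chart_image_open.
have l0 : l 0 = cmap c p by rewrite /l /line scale0r addr0.
have cl : continuous l by exact: continuous_line.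
have Ol0 : open_nbhs (0 : R^o) (l @^-1` O).
  split; first by apply: open_comp => // t _; exact: cl.
  by rewrite /preimage/= l0; exists p.
exists (cinv c \o l); split.
- by rewrite /= l0 ccK.
- have := open_nbhs_nbhs Ol0; apply: filterS => t -[z [cz psiz] zl].
  rewrite /= -zl ccK //; split=> //.
  apply/(hslice cz) => i di; rewrite zl /l /line !mxE vi // mulr0 addr0.
  by apply: (hslice cp).1.
- exists (l @^-1` O) => // k.
  exact: (Ck_on_line_comp (cmap c p) w oO (hct k)).
- have dtl : differentiable tau (l 0) by rewrite l0.
  have [dl dlE] := diff_line_comp dtl.
  rewrite derive1E; rewrite [RHS](deriveE _ dl) dlE scale1r.
  by rewrite -/l l0 tau_sigma.
Qed.

Lemma velocity_sliceP v : velocity S p v <->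
  forall i : 'I_n, (d <= i)%N -> 'd sigma (cmap psi p) v 0 i = 0.
Proof. by split; [exact: velocity_slice1 | exact: velocity_slice2]. Qed.

Lemma velocity_vspace : exists W : {vspace 'rV[R]_n},
  forall v, v \in W <-> velocity S p v.
Proof.
(* The vectors satisfying the criterion form the kernel of [D sigma] followed
   by the projection onto the coordinates of index at least [d]. *)
pose mask := diag_mx (\row_(i < n) (d <= i)%:R) : 'M[R]_n.
exists (lker (linfun (mulmxr mask \o 'd sigma (cmap psi p)))) => v.
rewrite memv_ker lfunE /=; split=> [/eqP/rowP vi|/velocity_slice1 vi].
  apply: velocity_slice2 => i di.
  by have := vi i; rewrite mul_mx_diag !mxE di mulr1.
apply/eqP/rowP => i; rewrite mul_mx_diag !mxE.
by case: leqP => [/vi ->|_]; rewrite ?mul0r ?mulr0.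
Qed.

End slice.

Lemma mem_Tan_submanifold (R : realType) (n d : nat) (N : charted R n)
    (S : set N) (p : N) : smooth_manifold N -> submanifold d S -> S p ->
  forall v, v \in Tan S p <-> velocity S p v.
Proof.
move=> hN [_ hS] Sp; have [c [hc cp htr hsl]] := hS _ Sp.
have [hct htc] := htr p.
have [W hW] := velocity_vspace hN hc cp Sp hct htc hsl.
exact: mem_Tan hW.
Qed.

Lemma submanifold_setT (R : realType) (n : nat) (N : charted R n) :
  smooth_manifold N -> submanifold n [set: N].
Proof.
case=> _ _ hc ht; split=> // q _; have [hcq qq] := hc q.
exists (chart_at q); split=> // z _; split=> // _ i.
by rewrite leqNgt ltn_ord.
Qed.

(** The whole manifold is its own slice, with no coordinate constrained. *)
Lemma Tan_setT (R : realType) (n : nat) (N : charted R n) (p : N) :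
  smooth_manifold N -> Tan [set: N] p = fullv.
Proof.
move=> hN; have hS := submanifold_setT hN.
apply/vspaceP => v; rewrite memvf; apply/(mem_Tan_submanifold hN hS I).
have [_ _ /(_ p)[hcp pp] ht] := hN.
apply/(velocity_sliceP (d := n) hN hcp pp I (ht p p) (ht p p)).
  by move=> z _; split=> // _ i; rewrite leqNgt ltn_ord.
by move=> i; rewrite leqNgt ltn_ord.
Qed.

(** * Products of copies of a Euclidean space *)

Section blocks.
Context {R : realType} {j n : nat}.

(** R^(j * n) is seen as the product of [j] copies of R^n, with the flattening
    [mxvec] that the charts of a power of a manifold use. *)
Definition block (a : 'I_j) : {linear 'rV[R]_(j * n) -> 'rV[R]_n} :=
  row a \o vec_mx.

Definition block_in (a : 'I_j) : {linear 'rV[R]_n -> 'rV[R]_(j * n)} :=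
  mxvec \o mulmx (delta_mx a 0 : 'cV_j).

Definition block_diag : {linear 'rV[R]_n -> 'rV[R]_(j * n)} :=
  mxvec \o mulmx (const_mx 1 : 'cV_j).

Lemma block_mxvec (a : 'I_j) (f : 'I_j -> 'rV[R]_n) :
  block a (mxvec (\matrix_b f b)) = f a.
Proof. by rewrite /block /= mxvecK rowK. Qed.

Lemma block_inK (a b : 'I_j) (v : 'rV[R]_n) :
  block a (block_in b v) = if a == b then v else 0.
Proof.
rewrite /block /= mxvecK; apply/rowP => i.
rewrite !mxE big_ord1 !mxE eqxx andbT.
by case: eqP => _; rewrite ?mul1r ?mul0r ?mxE.
Qed.

Lemma block_diagK (a : 'I_j) (v : 'rV[R]_n) : block a (block_diag v) = v.
Proof.
rewrite /block /= mxvecK; apply/rowP => i.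
by rewrite !mxE big_ord1 !mxE mul1r.
Qed.

Lemma eq_block (u v : 'rV[R]_(j * n)) :
  (forall a, block a u = block a v) -> u = v.
Proof.
move=> uv; rewrite -[u]vec_mxK -[v]vec_mxK; congr mxvec.
by apply/row_matrixP => a; exact: uv.
Qed.

Lemma sum_block_in (f : 'I_j -> 'rV[R]_n) :
  \sum_b block_in b (f b) = mxvec (\matrix_b f b).
Proof.
apply: eq_block => a; rewrite block_mxvec linear_sum (bigD1 a) //=.
rewrite -[RHS]addr0; congr (_ + _); first by rewrite [LHS]block_inK eqxx.
by apply: big1 => b; rewrite eq_sym => /negPf ab; rewrite [LHS]block_inK ab.
Qed.

End blocks.

(** Differentiability comes from writing the map as a sum over the factors; once
    it is known, the differential is read off by projecting onto each factor,
    which avoids differentiating the sum. *)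
Lemma diff_blocks (R : realType) (j m n : nat)
    (f : 'I_j -> 'rV[R]_m -> 'rV[R]_n) (u : 'rV[R]_(j * m)) :
  (forall a, differentiable (f a) (block a u)) ->
  let h := fun v => mxvec (\matrix_a f a (block a v)) in
  differentiable h u /\
  forall a v, block a ('d h u v) = 'd (f a) (block a u) (block a v).
Proof.
move=> df h.
have dfb a : differentiable (f a \o block a) u.
  apply: differentiable_comp => //.
  exact/linear_differentiable/linear_mx_continuous.
have hE : h = \sum_b (block_in b \o (f b \o block b)).
  by apply/funext => v; rewrite /h -sum_block_in fct_sumE.
have dh : differentiable h u.
  rewrite hE; apply: differentiable_sum => b.
  by have [] := diff_linear_comp (linear_mx_continuous (block_in b)) (dfb b).
split=> // a v.
have [_ bh] := diff_linear_comp (linear_mx_continuous (block a)) dh.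
have -> : block a ('d h u v) = 'd (block a \o h) u v by rewrite bh.
have -> : block a \o h = f a \o block a.
  by apply/funext => w; exact: block_mxvec.
have cb := linear_mx_continuous (block a : {linear 'rV[R]_(j * m) -> _}).
have db := linear_differentiable u cb.
by rewrite (diff_comp db (df a)) (diff_lin _ cb).
Qed.

(** * The tangent space of the diagonal *)

(** A curve in the diagonal is [j] copies of one curve; the hypothesis on [j]
    provides a factor from which to recover it. *)
Lemma velocity_diag (R : realType) (n j : nat) (N : charted R n) (G : set N)
    (p : N) (v : 'rV[R]_(j * n)) : (0 < j)%N ->
  velocity (@diag N j G : set (power N j)) (fun=> p) v <->
  exists2 t, velocity G p t & v = block_diag t.
Proof.
move=> j0; pose a0 := Ordinal j0; split.
- case=> c [c0 cG sc ->].
  set h : R^o -> 'rV[R]_(j * n) := cmap _ \o c in sc.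
  have dh := smooth_near_differentiable sc.
  have cb := linear_mx_continuous (block a0 : {linear 'rV[R]_(j * n) -> _}).
  have hb a : block a \o h = cmap (chart_at p) \o (fun t => c t a).
    by apply/funext => t; exact: block_mxvec.
  exists (derive1 (block a0 \o h) 0); first exists (fun t => c t a0).
    split.
    + by rewrite c0.
    + by apply: filterS cG => t [[Gt _] /= dt].
    + by have := smooth_near_linear_comp cb sc; rewrite hb.
    + by rewrite hb.
  apply: eq_block => a; rewrite block_diagK.
  have ca := linear_mx_continuous (block a : {linear 'rV[R]_(j * n) -> _}).
  rewrite -(derive1_linear_comp ca dh) !derive1E !hb.
  apply: near_eq_derive; apply: filterS cG => t [[_ Gt] _] /=.
  by rewrite (Gt a a0).
- case=> t [c [c0 cG sc ->]] ->.
  set h : R^o -> 'rV[R]_n := cmap _ \o c in sc.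
  have dh := smooth_near_differentiable sc.
  have cd := linear_mx_continuous (block_diag : {linear _ -> 'rV[R]_(j * n)}).
  have hE : block_diag \o h =
      cmap (@power_chart R n N j (fun=> p)) \o (fun t (_ : 'I_j) => c t).
    by apply/funext => s; apply: eq_block => a; rewrite block_mxvec block_diagK.
  exists (fun t (_ : 'I_j) => c t); split.
  + by rewrite c0.
  + by apply: filterS cG => s [Gs ds]; split=> //; split.
  + by have := smooth_near_linear_comp cd sc; rewrite hE.
  + by rewrite -(derive1_linear_comp cd dh) hE.
Qed.

Lemma mem_Tan_diag (R : realType) (n d j : nat) (N : charted R n) (G : set N)
    (p : N) : smooth_manifold N -> submanifold d G -> G p -> (0 < j)%N ->
  forall v, v \in Tan (@diag N j G : set (power N j)) (fun=> p) <->
    exists2 t, t \in Tan G p & v = block_diag t.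
Proof.
move=> hN hG Gp j0 v.
have TG := mem_Tan_submanifold hN hG Gp.
pose D : 'Hom('rV[R]_n, 'rV[R]_(j * n)) := linfun block_diag.
have DE u : D u = block_diag u by rewrite lfunE.
have TD u : u \in (D @: Tan G p)%VS <->
    exists2 t, t \in Tan G p & u = block_diag t.
  split=> [/memv_imgP[t Tt ->]|[t Tt ->]]; first by exists t.
  by rewrite -DE memv_img.
rewrite (mem_Tan (N := power N j) (W := (D @: Tan G p)%VS)).
  by rewrite velocity_diag //; split=> -[t Tt ->]; exists t => //; apply/TG.
move=> u; rewrite TD velocity_diag //.
by split=> -[t Tt ->]; exists t => //; apply/TG.
Qed.

(** * The differential of the map on the configuration space *)

(** Injective families form an open set because [M] is Hausdorff.  Without this
    the default value in the charts of [Omega M j] could interfere with the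
    local representative of [tilde F]. *)
Lemma offdiag_near (R : realType) (m j : nat) (M : charted R m)
    (y : 'I_j -> M) : smooth_manifold M -> offdiag y ->
  \forall u \near cmap (power_chart y) y,
    @offdiag M j (cinv (power_chart y) u).
Proof.
case=> hsM _ hc _ oy; set u0 := cmap _ _.
have bu0 a : block a u0 = cmap (chart_at (y a)) (y a).
  by rewrite /u0 block_mxvec.
have cy a : {for u0, continuous (fun u => cinv (chart_at (y a)) (block a u))}.
  apply: continuous_comp.
    exact: (linear_mx_continuous (block a : {linear 'rV[R]_(j * m) -> _})).
  have [[_ _ _ _ +] ya] := hc (y a); apply.
  by rewrite bu0; exists (y a).
have cyE a : cinv (chart_at (y a)) (block a u0) = y a.
  by have [[_ _ cK _ _] ya] := hc (y a); rewrite bu0 cK.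
suff sep a b : a != b -> \forall u \near u0,
    cinv (chart_at (y a)) (block a u) <> cinv (chart_at (y b)) (block b u).
  have : \forall u \near u0, forall a b : 'I_j, a != b ->
      cinv (chart_at (y a)) (block a u) <> cinv (chart_at (y b)) (block b u).
    have FF : Filter (nbhs u0) by exact: nbhs_filter.
    apply: (@filter_forall _ _ _ (nbhs u0) FF) => a.
    apply: (@filter_forall _ _ _ (nbhs u0) FF) => b.
    have [->|ab] := eqVneq a b; first by apply: (filterS _ filterT).
    by apply: filterS (sep a b ab).
  by apply: filterS.
move=> ab; have := hsM; rewrite open_hausdorff => /(_ (y a) (y b)).
have /eqP yab := oy a b ab; case/(_ yab) => -[A B] /= [].
rewrite !inE => Aya Byb [oA oB AB0].
have nA : \forall u \near u0, A (cinv (chart_at (y a)) (block a u)).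
  by apply: cy; rewrite cyE; exact: open_nbhs_nbhs.
have nB : \forall u \near u0, B (cinv (chart_at (y b)) (block b u)).
  by apply: cy; rewrite cyE; exact: open_nbhs_nbhs.
apply: filterS2 nA nB => u Au Bu uab.
suff : (A `&` B) (cinv (chart_at (y a)) (block a u)).
  by rewrite AB0.
by split; [exact: Au | move: Bu; rewrite -uab].
Qed.

Lemma limg_blocks (R : realType) (j m n : nat)
    (D : 'Hom('rV[R]_(j * m), 'rV[R]_(j * n)))
    (Db : 'I_j -> 'Hom('rV[R]_m, 'rV[R]_n)) :
  (forall a w, block a (D w) = Db a (block a w)) ->
  forall v, v \in limg D <-> forall a, block a v \in limg (Db a).
Proof.
move=> bD v; split=> [/memv_imgP[w _ ->] a|hv].
  by rewrite bD memv_img // memvf.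
have /choice[w wE] : forall a, exists w, block a v = Db a w.
  by move=> a; have /memv_imgP[w _ ->] := hv a; exists w.
have -> : v = D (mxvec (\matrix_a w a)).
  by apply: eq_block => a; rewrite bD block_mxvec.
by rewrite memv_img // memvf.
Qed.

Lemma differentialE (R : realType) (m n : nat) (M : charted R m)
    (N : charted R n) (F : M -> N) (x : M) (v : 'rV[R]_m) :
  differential F x v = 'd (local_rep F x) (cmap (chart_at x) x) v.
Proof. exact: lfunE. Qed.

(** Near the point, the local representative of [tilde F] applies in each factor
    a local representative of [F], so that its differential is the direct sum
    of those of [F]. *)
Lemma limg_differential_tilde (R : realType) (m n j : nat)
    (M : charted R m) (N : charted R n) (F : M -> N) (y : Omega M j) :
  smooth_manifold M -> smooth_map F ->
  forall v, v \in limg (differential (tilde F (j := j)) y) <->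
    forall a, block a v \in limg (differential F (set_val y a)).
Proof.
move=> hM [_ sF]; pose z : 'I_j -> M := set_val y.
have oz : offdiag z by exact: set_valP.
set u0 := cmap (power_chart z) z.
have bu0 a : block a u0 = cmap (chart_at (z a)) (z a).
  by rewrite /u0 block_mxvec.
have df a : differentiable (local_rep F (z a)) (block a u0).
  by rewrite bu0; exact: smooth_near_differentiable (sF (z a)).
pose h (u : 'rV[R]_(j * m)) : 'rV[R]_(j * n) :=
  mxvec (\matrix_a local_rep F (z a) (block a u)).
have [dh dhE] : differentiable h u0 /\ forall a w, block a ('d h u0 w) =
    'd (local_rep F (z a)) (block a u0) (block a w) by exact: diff_blocks.
have [_ dE] : differentiable (local_rep (tilde F (j := j)) y) u0 /\
    'd (local_rep (tilde F (j := j)) y) u0 = 'd h u0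
      :> ('rV[R]_(j * m) -> 'rV[R]_(j * n)).
  apply: near_eq_diff dh; apply: filterS (offdiag_near hM oz) => u ou.
  apply: eq_block => a; rewrite !block_mxvec /local_rep /= /tilde.
  have yK := insubdK y (mem_set ou).
  have yKa : set_val (insubd y (cinv (power_chart z) u)) a =
      cinv (chart_at (z a)) (block a u) := congr1 (fun f : _ -> _ => f a) yK.
  by congr (cmap _ (F _)); exact: esym yKa.
have bD a w : block a (differential (tilde F (j := j)) y w) =
    differential F (z a) (block a w).
  have -> : differential (tilde F (j := j)) y w =
      'd (local_rep (tilde F (j := j)) y) u0 w by exact: differentialE.
  have -> : 'd (local_rep (tilde F (j := j)) y) u0 w = 'd h u0 w.
    exact: (congr1 (fun f : 'rV[R]_(j * m) -> 'rV[R]_(j * n) => f w) dE).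
  by rewrite dhE bu0 -differentialE.
exact: limg_blocks bD.
Qed.

(** * Transversality and orthogonal complements *)

(** Pairing with a basis of [W] gives fewer than [\dim E] linear equations, hence
    a nonzero common solution. *)
Lemma exists_orthogonal (K : fieldType) (E : vectType K) (G : E -> E -> K)
    (W : {vspace E}) :
  (forall w, scalar (G^~ w)) -> (forall u, scalar (G u)) -> W != fullv ->
  exists2 u, u != 0 & forall w, w \in W -> G u w = 0.
Proof.
move=> Gl Gr WE.
pose L u : 'rV[K]_(\dim W) := \row_i G u (vbasis W)`_i.
have linL : linear L by move=> a u v; apply/rowP => i; rewrite !mxE Gl.
pose f : 'Hom(E, 'rV[K]_(\dim W)) :=
  linfun (HB.pack L (GRing.isLinear.Build _ _ _ _ _ linL) : {linear _ -> _}).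
have fE u : f u = L u by rewrite lfunE.
have kf : lker f != 0%VS.
  have ltW : (\dim W < \dim {:E})%N.
    rewrite ltnNge; apply: contra WE => leE.
    by rewrite eqEdim subvf.
  apply: contraTneq ltW => kf0; rewrite -leqNgt.
  rewrite -(limg_ker_dim f fullv) kf0 capv0 dimv0 add0n.
  by rewrite (leq_trans (dimvS (subvf _))) // dimvf /dim /= mul1n.
exists (vpick (lker f)); first by rewrite vpick0.
have := memv_pick (lker f); rewrite memv_ker fE => /eqP Lu0 w.
move=> /coord_vbasis ->.
pose Gu : {scalar E} := HB.pack (G (vpick (lker f)))
  (GRing.isLinear.Build _ _ _ _ _ (Gr (vpick (lker f)))).
rewrite -[G _]/(Gu : _ -> _) linear_sum big1 // => i _.
rewrite linearZ /=; move/rowP/(_ i): Lu0; rewrite !mxE => ->.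
by rewrite mulr0.
Qed.

(** Here [A] stands for the image of [D tilde F], the direct sum of the [V a], and
    [B] for the tangent space of the diagonal.  For the inner product of the
    product, a family [v] is orthogonal to [A] when each [v a] is orthogonal to
    [V a], and to the diagonal copy of [T] when its sum is orthogonal to [T];
    the condition on the right says that only 0 is orthogonal to [A + B]. *)
Lemma block_transverseP (R : realType) (n j : nat)
    (g : {dot 'rV[R]_n for idfun}) (V : 'I_j -> {vspace 'rV[R]_n})
    (T : {vspace 'rV[R]_n}) (A B : {vspace 'rV[R]_(j * n)}) :
  (forall u, u \in A <-> forall a, block a u \in V a) ->
  (forall u, u \in B <-> exists2 t, t \in T & u = block_diag t) ->
  (A + B)%VS = fullv <->
  forall v : 'I_j -> 'rV[R]_n, (forall a, v a \in orthov g (V a)) ->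
    \sum_a v a \in orthov g T -> forall a, v a = 0.
Proof.
move=> hA hB; split=> [AB v vV vT a|orth0].
  have : mxvec (\matrix_b v b) \in (A + B)%VS by rewrite AB memvf.
  case/memv_addP => l /hA lV [_ /hB[t tT ->] vE].
  (* Decompose the orthogonal family [v] itself along [A + B]: all the squared
     lengths then add up to a pairing of the sum of [v] with [t]. *)
  have v_split b : v b = block b l + t.
    by rewrite -(block_mxvec b v) vE linearD block_diagK.
  have : \sum_b g (v b) (v b) = 0.
    transitivity (\sum_b g (v b) t).
      apply: eq_bigr => b _; rewrite {2}v_split linearDr /=.
      by rewrite (mem_orthovP (vV b) _ (lV b)) add0r.
    by rewrite -[RHS](mem_orthovP vT t tT) linear_sumlz.
  have ge0 b : 0 <= g (v b) (v b).
    have [->|/neq0_dnorm_gt0/ltW //] := eqVneq (v b) 0.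
    by rewrite linear0r.
  move=> /eqP; rewrite psumr_eq0 // => /allP/(_ a).
  rewrite mem_index_enum => /(_ isT) /=.
  by apply: contraTeq => /neq0_dnorm_gt0 g0; rewrite gt_eqF.
apply/eqP/negPn/negP => AB.
pose G (u w : 'rV[R]_(j * n)) := \sum_a g (block a u) (block a w).
have Gl w : scalar (G^~ w).
  move=> k u v; rewrite /G mulr_sumr -big_split; apply: eq_bigr => a _.
  by rewrite linearP linearPl.
have Gr u : scalar (G u).
  move=> k w v; rewrite /G mulr_sumr -big_split; apply: eq_bigr => a _.
  by rewrite linearP linearPr.
have [u u0 uAB] := exists_orthogonal Gl Gr AB.
case/eqP: u0; apply: eq_block => a; rewrite linear0.
apply: (orth0 (fun a => block a u)) a => [a|].
  apply/mem_orthovP => l lV.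
  have : G u (block_in a l) = 0.
    apply: uAB; apply: (subvP (addvSl A B)); apply/hA => b.
    by rewrite block_inK; case: eqP => [->//|_]; exact: mem0v.
  rewrite /G (bigD1 a) //= [X in g _ X]block_inK eqxx big1 ?addr0 // => b ba.
  by rewrite [X in g _ X]block_inK (negPf ba) linear0r.
apply/mem_orthovP => t tT; rewrite linear_sumlz.
have G0 : G u (block_diag t) = 0.
  by apply: uAB; apply: (subvP (addvSr A B)); apply/hB; exists t.
rewrite -[RHS]G0; apply: eq_bigr => b _.
by rewrite [X in _ = g _ X]block_diagK.
Qed.

(** The vector attached to [T] is minus the sum of the others, so that it can be
    eliminated. *)
Lemma strongly_transverse_rconsP (R : realType) (E : vectType R)
    (g : {dot E for idfun}) (k : nat) (V : k.-tuple {vspace E})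
    (T : {vspace E}) :
  strongly_transverse_subspaces g [tuple of rcons V T] <->
  forall v : 'I_k -> E, (forall i, v i \in orthov g (tnth V i)) ->
    \sum_i v i \in orthov g T -> forall i, v i = 0.
Proof.
pose w (i : 'I_k) : 'I_k.+1 := widen_ord (leqnSn k) i.
have tw i : tnth [tuple of rcons V T] (w i) = tnth V i.
  by rewrite !(tnth_nth T) nth_rcons /= size_tuple ltn_ord.
have tm : tnth [tuple of rcons V T] ord_max = T.
  by rewrite (tnth_nth T) nth_rcons /= size_tuple ltnn eqxx.
split=> [hst v vV vT i|h v vV v0].
  pose v' (i : 'I_k.+1) := oapp v (- \sum_i v i) (unlift ord_max i).
  have v'w l : v' (w l) = v l.
    have -> : w l = lift ord_max l by apply: ord_inj; rewrite lift_max.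
    by rewrite /v' liftK.
  have v'm : v' ord_max = - \sum_i v i by rewrite /v' unlift_none.
  rewrite -v'w; apply: hst => [l|]; last first.
    rewrite big_ord_recr /= v'm.
    have -> : \sum_l v' (w l) = \sum_l v l by apply: eq_bigr.
    by rewrite subrr.
  case: (unliftP ord_max l) => [l' ->|->]; last by rewrite v'm tm rpredN.
  have -> : lift ord_max l' = w l' by apply: ord_inj; rewrite lift_max.
  by rewrite v'w tw.
have vw0 i : v (w i) = 0.
  apply: (h (v \o w)) => [l|] /=; first by rewrite -tw.
  move: v0; rewrite big_ord_recr /= => /eqP; rewrite addr_eq0 => /eqP ->.
  by rewrite rpredN -tm.
have vm0 : v ord_max = 0.
  move: v0; rewrite big_ord_recr /= big1 ?add0r // => i _.
move=> i; case: (unliftP ord_max i) => [l ->|-> //].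
by have -> : lift ord_max l = w l by apply: ord_inj; rewrite lift_max.
Qed.

Lemma orthov_fullv (R : realType) (E : vectType R) (g : {dot E for idfun}) u :
  u \in orthov g fullv -> u = 0.
Proof.
move=> /mem_orthovP/(_ u (memvf u)).
by apply: contra_eq => u0; rewrite gt_eqF //; exact: neq0_dnorm_gt0.
Qed.

(** * Strong transversality at a point *)

Section fixed_map.
Context {R : realType} {m n : nat} {M : charted R m} {N : charted R n}
  {F : M -> N} (hM : smooth_manifold M) (hN : smooth_manifold N)
  (hF : smooth_map F) (g : {dot 'rV[R]_n for idfun}).

Lemma transverse_at_tildeP (d j : nat) (G : set N) (p : N) (y : Omega M j) :
  submanifold d G -> G p -> (0 < j)%N -> (forall a, F (set_val y a) = p) ->
  transverse_at (tilde F (j := j)) (@diag N j G : set (power N j)) y <->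
  forall v : 'I_j -> 'rV[R]_n,
    (forall a, v a \in orthov g (limg (differential F (set_val y a)))) ->
    \sum_a v a \in orthov g (Tan G p) -> forall a, v a = 0.
Proof.
move=> hG Gp j0 yp.
have ty : tilde F y = (fun=> p) by apply/funext.
have hA := limg_differential_tilde y hM hF.
have hB := mem_Tan_diag hN hG Gp j0.
rewrite -(block_transverseP g hA hB) /transverse_at ty.
by split=> [|h _] //; apply; split.
Qed.

(** Points of [Omega M j] over [p] are injective families of elements of [x].  The
    full family yields the condition on the right; a shorter family is handled
    by extending it by 0. *)
Lemma strongly_transverse_atP (d k : nat) (G : set N) (p : N)
    (x : k.-tuple M) : submanifold d G -> G p -> uniq x ->
  (forall y : M, F y = p <-> y \in x) ->
  strongly_transverse_at F G p <->
  forall v : 'I_k -> 'rV[R]_n,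
    (forall i, v i \in orthov g (limg (differential F (tnth x i)))) ->
    \sum_i v i \in orthov g (Tan G p) -> forall i, v i = 0.
Proof.
move=> hG Gp x_uniq x_fiber; split=> [hst v vV vT i|h j j0 y yp].
  (* The transversality condition only concerns nonempty families; the index [i]
     excludes the case of an empty fiber. *)
  have k0 : (0 < k)%N by exact: leq_ltn_trans (leq0n i) (ltn_ord i).
  have ox : offdiag (tnth x).
    by move=> a b ab /(tuple_uniqP _ x_uniq)/eqP; rewrite (negPf ab).
  pose y : Omega M k := exist _ (tnth x : power M k) (mem_set ox).
  have yx : set_val y = tnth x by [].
  have yp a : F (set_val y a) = p by rewrite yx; apply/x_fiber/mem_tnth.
  by apply: ((transverse_at_tildeP hG Gp k0 yp).1 (hst k k0 y yp)).
apply/(transverse_at_tildeP hG Gp j0 yp) => v vV vT a.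
have /choice[s sx] : forall b, exists i, set_val y b = tnth x i.
  by move=> b; apply/tnthP; apply/x_fiber.
have s_inj : injective s.
  move=> b c sbc; apply/eqP; apply: contraPT (set_valP y) => bc oy.
  by apply: (oy b c bc); apply: etrans (sx b) _; rewrite sbc -sx.
(* [w] extends [v] by 0 along the injection [s]: each of its sums has at most
   one term. *)
pose w i := \sum_(b | s b == i) v b.
have <- : w (s a) = v a.
  by rewrite /w (big_pred1 a) // => b; rewrite (inj_eq s_inj).
apply: h => [i|].
  by apply: rpred_sum => b /eqP <-; rewrite -sx.
suff -> : \sum_i w i = \sum_b v b by [].
by rewrite [RHS](partition_big s predT).
Qed.

End fixed_map.

Theorem theorem21 (R : realType) (m n d k : nat)
    (M : charted R m) (N : charted R n) (F : M -> N)
    (Gamma : set N) (p : N) (x : k.-tuple M)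
    (g : {dot 'rV[R]_n for idfun})
    (hM : smooth_manifold M) (hN : smooth_manifold N)
    (hF : immersion F)
    (hGamma : submanifold d Gamma) (hp : Gamma p)
    (x_uniq : uniq x) (x_fiber : forall y : M, F y = p <-> y \in x) :
  let V : k.-tuple {vspace 'rV[R]_n} :=
    [tuple limg (differential F (tnth x i)) | i < k] in
  (strongly_transverse_at F Gamma p <->
     strongly_transverse_subspaces g [tuple of rcons V (Tan Gamma p)]) /\
  (strongly_self_transverse_at F p <-> strongly_transverse_subspaces g V).
Proof.
move=> V; have [sF _] := hF.
have tV i : tnth V i = limg (differential F (tnth x i)) by rewrite tnth_mktuple.
split.
  rewrite (strongly_transverse_atP hM hN sF g hGamma hp x_uniq x_fiber).
  rewrite strongly_transverse_rconsP.
  by split=> h v vV; apply: h => i; have := vV i; rewrite tV.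
rewrite /strongly_self_transverse_at.
rewrite (strongly_transverse_atP hM hN sF g (submanifold_setT hN) I x_uniq
  x_fiber).
rewrite Tan_setT //; split=> h v vV v0; apply: h => [i|].
- by have := vV i; rewrite tV.
- by rewrite v0 mem0v.
- by rewrite tV.
- exact: orthov_fullv v0.
Qed.
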